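(* Consider the Int-GARCH(1,1,1) model: for integers $t$, $$r_t=h_t\cdot[\epsilon_t-\eta_t,\ \epsilon_t+\eta_t]=[\lambda_t-\delta_t,\ \lambda_t+\delta_t],\qquad \lambda_t=h_t\epsilon_t,\ \delta_t=h_t\eta_t,$$ $$h_t=\mu+\alpha_1|\lambda_{t-1}|+\beta_1\delta_{t-1}+\gamma_1h_{t-1},$$ where $\mu>0$, $\alpha_1,\beta_1,\gamma_1>0$ are constants, $\{\epsilon_t\}$ are i.i.d. $N(0,1)$, $\{\eta_t\}$ are i.i.d. $\Gamma(k,1)$ (shape $k>0$, scale 1), the two sequences are mutually independent, and $(\epsilon_t,\eta_t)$ is independent of $\{h_s:s\le t\}$. Put $x_t=\alpha_1|\epsilon_t|+\beta_1\eta_t+\gamma_1$, $C_1=E(x_t)$, $C_2=E(x_t^2)$. Assume $\{r_t\}$ starts from its infinite past with finite variance and that $C_2<C_1<1$. Then for the covariance of the random intervals $r_t$ and $r_{t+s}$, $$\mathrm{Cov}(r_t,r_{t+s})=\begin{cases}(1+k+k^2)E(h_t^2)-k^2[E(h_t)]^2,& s=0,\\ kE(h_th_{t+s}\eta_t)-k^2[E(h_t)]^2,& |s|>0,\end{cases}$$ where $E(h_t)=\dfrac{\mu}{1-C_1}$ and $E(h_t^2)=\mu^2\dfrac{C_1+1}{(C_2-1)(C_1-1)}$.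
   Context: Here $\cdot$ denotes scalar multiplication of an interval. The covariance of two random intervals $r_t=[\lambda_t-\delta_t,\lambda_t+\delta_t]$ and $r_s=[\lambda_s-\delta_s,\lambda_s+\delta_s]$ (in the sense of Körner for random compact convex sets) is $\mathrm{Cov}(r_t,r_s)=\mathrm{Cov}(\lambda_t,\lambda_s)+\mathrm{Cov}(\delta_t,\delta_s)$.
   Formalization: For s<0 the stated formula is false (off by k²β₁C₁^{|s|-1}E(h_t²)), so η_t is replaced by η at the earlier of t, t+s; (ε_t,η_t) is taken independent of h_s (s≤t) and of ε_s, η_s (s<t), and finite variance is read as E(h_t²) bounded in t. *)

(* Defs.v *)
From HB Require Import structures.
From mathcomp Require Import all_boot all_order all_algebra.
From mathcomp Require Import all_classical all_reals all_analysis.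

Set Implicit Arguments.
Unset Strict Implicit.
Unset Printing Implicit Defensive.
Import Order.TTheory GRing.Theory Num.Theory.
Import numFieldNormedType.Exports.
Local Open Scope classical_set_scope.
Local Open Scope ring_scope.

Definition rv_gen d (T : measurableType d) (R : realType) (I : Type)
  (X : I -> T -> R) (J : set I) : set (set T) :=
  \bigcup_(i in J) [set X i @^-1` B | B in (@measurable _ R)].

Definition mutual_indep d (T : measurableType d) (R : realType)
  (P : probability T R) (K : Type) (F : K -> set (set T)) : Prop :=
  forall (n : nat) (f : 'I_n -> K), injective f ->
  forall A : 'I_n -> set T, (forall i, F (f i) (A i)) ->
  P (\bigcap_(i in [set: 'I_n]) A i) = (\prod_(i < n) P (A i))%E.

Definition indep2 d (T : measurableType d) (R : realType)
  (P : probability T R) (F G : set (set T)) : Prop :=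
  forall A B, F A -> G B -> P (A `&` B) = (P A * P B)%E.

Definition indep_rvs d (T : measurableType d) (R : realType)
  (P : probability T R) (I : Type) (X : I -> T -> R) : Prop :=
  mutual_indep P (fun i => <<s rv_gen X [set i] >>).

Definition gamma_unnorm {R : realType} (k x : R) : R :=
  if 0 < x then x `^ (k - 1) * expR (- x) else 0.

Definition Gamma_fun {R : realType} (k : R) : R :=
  fine (\int[lebesgue_measure]_(x in [set: R]) (gamma_unnorm k x)%:E)%E.

Definition gamma_pdf {R : realType} (k x : R) : R :=
  gamma_unnorm k x / Gamma_fun k.

Definition gamma_prob {R : realType} (k : R) : set R -> \bar R :=
  fun V => (\int[lebesgue_measure]_(x in V) (gamma_pdf k x)%:E)%E.

Definition has_law d (T : measurableType d) (R : realType)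
  (P : probability T R) (X : T -> R) (mu : set R -> \bar R) : Prop :=
  measurable_fun setT X /\
  forall B : set R, measurable B -> P (X @^-1` B) = mu B.

(* Covariance of random intervals [l1 - d1, l1 + d1], [l2 - d2, l2 + d2]
   (Koerner): Cov(l1,l2) + Cov(d1,d2). *)
Definition interval_cov d (T : measurableType d) (R : realType)
  (P : probability T R) (l1 d1 l2 d2 : T -> R) : \bar R :=
  (covariance P l1 l2 + covariance P d1 d2)%E.

(* Main.v *)
(* Almost surely h_t >= 0: the negative parts of h have uniformly bounded means
   which contract by a factor < 1, so they vanish.  Hence
   h_t = mu + h_{t-1} x_{t-1} almost surely, with x_{t-1} independent of h_{t-1},
   and the first two moments of h satisfy affine recursions of slopes C1, C2 in
   [0, 1) along Z; a bounded solution of such a recursion is its fixed point.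
   The covariances follow by splitting off the latest innovation, which is
   independent of the past, with E eps = 0, E eps^2 = 1, E eta = k and
   E eta^2 = k (k + 1). *)
Require Import Defs.
From HB Require Import structures.
From mathcomp Require Import all_boot all_order all_algebra.
From mathcomp Require Import ring lra.
From mathcomp Require Import all_classical all_reals all_analysis.
From mathcomp Require Import measurable_realfun.

Set Implicit Arguments.
Unset Strict Implicit.
Unset Printing Implicit Defensive.
Import Order.TTheory GRing.Theory Num.Theory.
Import numFieldNormedType.Exports.
Local Open Scope classical_set_scope.
Local Open Scope ring_scope.

(** An affine recursion of slope q in (0, 1) indexed by all of Z has, besides its fixed point c, the
    solutions c + A q^u, which blow up as u tends to -oo. The recursion alone therefore does not
    determine the moments of h; the uniform bound on E h_t^2 is what excludes A <> 0, for the first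
    moments through |h| <= 1 + h^2. The moments of the innovations have to be derived from their
    densities. Both laws are handled by one form of integration by parts between nonnegative
    integrands, F' = f - g with F vanishing at both ends, which needs no finiteness in advance: it
    gives E eps^2 = 1, E eps = 0 and Gamma(s + 1) = s Gamma(s). *)

(** ['E_P] is total, so the value of an expectation says nothing about integrability; here the two
    facts travel together. *)
Definition has_mean d (T : measurableType d) (R : realType)
    (P : probability T R) (X : T -> R) (a : R) : Prop :=
  P.-integrable setT (EFin \o X) /\ ('E_P[X] = a%:E)%E.

(** * Calculus of real random variables with a finite mean *)

Section has_mean_theory.
Context d (T : measurableType d) (R : realType) (P : probability T R).
Implicit Types (X Y : T -> R) (a b c : R).

Lemma has_mean_measurable X a : has_mean P X a -> measurable_fun setT X.
Proof. by move=> [/measurable_int /measurable_EFinP]. Qed.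

Lemma has_mean_Lfun X a : has_mean P X a -> X \in Lfun P 1.
Proof. by move=> [? _]; exact/Lfun1_integrable. Qed.

Lemma has_mean_integral X a :
  has_mean P X a -> (\int[P]_w (X w)%:E = a%:E)%E.
Proof. by move=> [_]; rewrite unlock. Qed.

Lemma has_mean_unique X a b : has_mean P X a -> has_mean P X b -> a = b.
Proof. by move=> [_ Ea] [_]; rewrite Ea => -[]. Qed.

Lemma integrable_has_mean X :
  P.-integrable setT (EFin \o X) -> exists a, has_mean P X a.
Proof.
move=> iX; exists (fine 'E_P[X]%E); split => //.
by rewrite fineK// expectation_fin_num//; exact/Lfun1_integrable.
Qed.

(** For a nonnegative variable the expectation is the integral of the absolute value, so a finite
    value gives integrability. *)
Lemma ge0_has_mean X a : measurable_fun setT X -> (forall w, 0 <= X w) ->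
  ('E_P[X] = a%:E)%E -> has_mean P X a.
Proof.
move=> mX X0 EX; split => //; apply/integrableP; split.
  exact/measurable_EFinP.
under eq_integral do rewrite /= ger0_norm//.
by move: EX; rewrite unlock => ->; rewrite ltry.
Qed.

Lemma has_mean_cst c : has_mean P (cst c) c.
Proof.
split; last exact: expectation_cst.
exact: finite_measure_integrable_cst.
Qed.

Lemma has_meanD X Y a b : has_mean P X a -> has_mean P Y b ->
  has_mean P (fun w => X w + Y w) (a + b).
Proof.
move=> hX hY; split.
  have := integrableD measurableT hX.1 hY.1.
  by apply: eq_integrable => // w _; rewrite /= EFinD.
rewrite (expectationD (has_mean_Lfun hX) (has_mean_Lfun hY)).
by rewrite hX.2 hY.2 EFinD.
Qed.

Lemma has_meanZ c X a : has_mean P X a -> has_mean P (fun w => c * X w) (c * a).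
Proof.
move=> hX; split.
  have := integrableZl measurableT c hX.1.
  by apply: eq_integrable => // w _; rewrite /= EFinM.
have -> : (fun w => c * X w) = c \o* X by apply/funext => w /=; rewrite mulrC.
by rewrite (expectationZl _ (has_mean_Lfun hX)) hX.2 EFinM.
Qed.

(** Measurability of [Y] is a separate premise because [P] need not be complete. *)
Lemma has_mean_ae X Y a : has_mean P X a -> measurable_fun setT Y ->
  {ae P, forall w, X w = Y w} -> has_mean P Y a.
Proof.
move=> hX mY XY.
have mY' : measurable_fun setT (EFin \o Y) by exact/measurable_EFinP.
have mX' : measurable_fun setT (EFin \o X).
  exact/measurable_EFinP/has_mean_measurable/hX.
split.
  apply/integrableP; split => //.
  have /integrableP[_] := hX.1; congr (_ < _)%E; apply: ae_eq_integral => //.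
  - exact: measurableT_comp.
  - exact: measurableT_comp.
  - by apply: filterS XY => w /= ->.
rewrite unlock -(has_mean_integral hX); apply/esym/ae_eq_integral => //.
by apply: filterS XY => w /= ->.
Qed.

Lemma has_mean_le_ae X Y a b : has_mean P X a -> has_mean P Y b ->
  {ae P, forall w, X w <= Y w} -> a <= b.
Proof.
move=> hX hY XY; have hZ := has_meanD hY (has_meanZ (-1) hX).
have mZ := has_mean_measurable hZ.
(* The positive part of Y - X is nonnegative everywhere, as [expectation_ge0] asks, and almost
   surely equal to Y - X. *)
suff [_ EZ] : has_mean P (fun w => Num.max (Y w + -1 * X w) 0) (b + -1 * a).
  have : (0 <= b + -1 * a)%R.
    rewrite -lee_fin -EZ; apply: expectation_ge0 => w.
    by rewrite le_max lexx orbT.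
  by rewrite mulN1r subr_ge0.
apply: (has_mean_ae hZ); first exact: measurable_maxr.
by apply: filterS XY => w XYw; rewrite max_l// mulN1r subr_ge0.
Qed.

Lemma has_mean_le X Y a : has_mean P Y a -> measurable_fun setT X ->
  (forall w, `|X w| <= Y w) -> exists b, has_mean P X b.
Proof.
move=> hY mX XY; apply: integrable_has_mean.
apply: (le_integrable measurableT _ _ hY.1); first exact/measurable_EFinP.
by move=> w _; rewrite /= lee_fin (le_trans (XY w) (ler_norm _)).
Qed.

(** From |xy| <= x^2 + y^2. *)
Lemma has_mean_mul_le X Y a b : has_mean P (fun w => X w ^+ 2) a ->
  has_mean P (fun w => Y w ^+ 2) b ->
  measurable_fun setT X -> measurable_fun setT Y ->
  exists c, has_mean P (fun w => X w * Y w) c.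
Proof.
move=> hX hY mX mY; apply: (has_mean_le (has_meanD hX hY)).
  exact: measurable_funM.
move=> w; rewrite ler_norml; apply/andP; split; nra.
Qed.

(** From |x| <= 1 + x^2. The explicit bound later turns the uniform bound on E h_t^2 into one on |E
    h_t|. *)
Lemma has_mean_sq X a : has_mean P (fun w => X w ^+ 2) a ->
  measurable_fun setT X -> exists2 c, has_mean P X c & `|c| <= 1 + a.
Proof.
move=> hX mX; have hX1 := has_meanD (has_mean_cst 1) hX.
have XX w : `|X w| <= 1 + X w ^+ 2.
  by rewrite ler_norml; apply/andP; split; nra.
have [c hc] := has_mean_le hX1 mX XX.
exists c => //; rewrite ler_norml; apply/andP; split.
  rewrite lerNl -mulN1r; apply: (has_mean_le_ae (has_meanZ (-1) hc) hX1).
  by apply: aeW => w; move: (XX w); rewrite ler_norml mulN1r lerNl => /andP[].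
apply: (has_mean_le_ae hc hX1).
by apply: aeW => w; move: (XX w); rewrite ler_norml => /andP[].
Qed.

End has_mean_theory.

(* The law of (X, Y) is a product measure, so Fubini applies. *)
Lemma has_mean_mul_indep d (T : measurableType d) (R : realType)
    (P : probability T R) (X Y : T -> R) (a b : R) :
  (forall A B, measurable A -> measurable B ->
    P (X @^-1` A `&` Y @^-1` B) = (P (X @^-1` A) * P (Y @^-1` B))%E) ->
  has_mean P X a -> has_mean P Y b -> has_mean P (fun w => X w * Y w) (a * b).
Proof.
move=> XY hX hY.
have mX := has_mean_measurable hX; have mY := has_mean_measurable hY.
have mZ : measurable_fun setT (fun w => (X w, Y w)) by exact: measurable_fun_pair.
pose X' : {mfun T >-> R} := HB.pack X (isMeasurableFun.Build _ _ _ _ _ mX).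
pose Y' : {mfun T >-> R} := HB.pack Y (isMeasurableFun.Build _ _ _ _ _ mY).
pose Z' : {mfun T >-> (R * R)%type} :=
  HB.pack (fun w => (X w, Y w)) (isMeasurableFun.Build _ _ _ _ _ mZ).
pose m1 := distribution P X'; pose m2 := distribution P Y'.
have mE S : measurable S -> (m1 \x m2)%E S = distribution P Z' S.
  apply: product_measure_unique => A B mA mB; rewrite -XY//.
pose f (p : R * R) := (p.1 * p.2)%:E.
have mf : measurable_fun setT f by apply/measurable_EFinP; exact: measurable_funM.
have intm1 : m1.-integrable setT (EFin : R -> \bar R).
  exact: integrable_pushforward hX.1 _.
have intm2 : m2.-integrable setT (EFin : R -> \bar R).
  exact: integrable_pushforward hY.1 _.
have E1 : (\int[m1]_x x%:E = a%:E)%E.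
  rewrite integral_distribution//; [exact: has_mean_integral hX|exact: hX.1].
have E2 : (\int[m2]_x x%:E = b%:E)%E.
  rewrite integral_distribution//; [exact: has_mean_integral hY|exact: hY.1].
(* By Tonelli the integral of |xy| is E|X| E|Y|, which is finite. *)
have intf : (m1 \x m2)%E.-integrable setT f.
  apply/integrable12ltyP => //.
  have fE x : (\int[m2]_y `|f (x, y)| = `|x|%:E * \int[m2]_y `|y%:E|)%E.
    rewrite -ge0_integralZl//; last by apply: measurableT_comp => //; exact: measurable_EFin.
    by apply: eq_integral => y _; rewrite /f/= normrM EFinM.
  under eq_integral do rewrite fE.
  have /integrableP[_ f1] := intm1; have /integrableP[_ f2] := intm2.
  rewrite ge0_integralZr//; last 2 first.
    by apply: measurableT_comp => //; exact: measurable_EFin.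
    exact: integral_ge0.
  apply: lte_mul_pinfty => //; first exact: integral_ge0.
  by rewrite ge0_fin_numE//; exact: integral_ge0.
have intZ : P.-integrable setT (fun w => f (X w, Y w)).
  apply/integrableP; split; first exact: measurableT_comp.
  have /integrableP[_] := intf.
  rewrite (eq_measure_integral (distribution P Z')); last by move=> S mS _; exact: mE.
  by rewrite ge0_integral_distribution//; exact: measurableT_comp.
split => //.
rewrite unlock -[LHS](@integral_distribution _ _ _ _ _ P Z' f)//.
rewrite (eq_measure_integral (m1 \x m2)%E); last by move=> S mS _; exact/esym/mE.
rewrite -integral12_prod_meas1// /fubini_F/f/=.
under eq_integral => x _.
  under eq_integral do rewrite EFinM.
  rewrite integralZl// E2.
  over.
by rewrite integralZr// E1.
Qed.

(** * Expectations under a law given by a density *)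

Section density.
Context d (T : measurableType d) (R : realType) (P : probability T R).
Variables (X : T -> R) (p : R -> R).
Hypotheses (mp : measurable_fun setT p) (p0 : forall x, 0 <= p x).
Hypothesis lawX : has_law P X
  (fun V => (\int[lebesgue_measure]_(x in V) (p x)%:E)%E).

Import HBNNSimple.

Let mX : measurable_fun setT X := lawX.1.
Let X' : {mfun T >-> R} := HB.pack X (isMeasurableFun.Build _ _ _ _ _ mX).
Local Notation m := (distribution P X').
Local Notation leb := (@lebesgue_measure R).

(** On each level set of [f] the claim is the hypothesis on the law; the finitely many levels are
    then summed. *)
Let integral_density_nnsfun (f : {nnsfun R >-> R}) :
  (\int[m]_x (f x)%:E = \int[leb]_x ((f x)%:E * (p x)%:E))%E.
Proof.
have mep : measurable_fun setT (EFin \o p) by exact/measurable_EFinP.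
have mind r : measurable_fun [set: R] (fun x : R => r * \1_(f @^-1` [set r]) x).
  by apply: measurable_funM => //; exact: measurable_indic.
under [LHS]eq_integral do rewrite fimfunE -fsumEFin//.
rewrite [LHS]ge0_integral_fsum//; last 2 first.
  - by move=> r; apply/measurable_EFinP; exact: mind.
  - by move=> n x _; rewrite EFinM nnfun_muleindic_ge0.
under [RHS]eq_integral.
  move=> x xD; rewrite fimfunE -fsumEFin// ge0_mule_fsuml; last first.
    by move=> r; rewrite EFinM nnfun_muleindic_ge0.
  over.
rewrite [RHS]ge0_integral_fsum//; last 2 first.
  - move=> r; apply: emeasurable_funM => //.
    by apply/measurable_EFinP; exact: mind.
  - move=> n x _; rewrite EFinM mule_ge0//; first by rewrite nnfun_muleindic_ge0.
    by rewrite lee_fin.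
apply: eq_fsbigr => r _.
(* A negative level has empty preimage since f >= 0; pulling the constant out of the integral below
   needs r >= 0. *)
have [r0|r0] := ltP r 0.
  rewrite preimage_nnfun0// indic0.
  by rewrite !integral0_eq// => x _; rewrite mulr0 ?mul0e.
have mfr : measurable (f @^-1` [set r]) by exact: measurable_funPTI.
have mr : measurable_fun [set: R] ((EFin \o p) \_ (f @^-1` [set r])).
  by apply/(measurable_restrictT _ mfr); exact: measurable_funTS.
rewrite integralZl_indic_nnsfun//= integral_indic// setIT.
rewrite -[X in (_ * X)%E = _]/(P (X @^-1` (f @^-1` [set r]))) lawX.2//.
rewrite integral_mkcond -ge0_integralZl//; last first.
  by move=> x _; rewrite patchE; case: ifPn => // _; rewrite lee_fin.
apply: eq_integral => x _; rewrite patchE indicE.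
by case: ifPn => _; rewrite ?mulr1 ?mulr0 ?mule0 ?mul0e.
Qed.

(** Monotone convergence along simple functions increasing to [u]; nonnegativity of [u] replaces
    integrability. *)
Lemma integral_density (u : R -> \bar R) :
  measurable_fun setT u -> (forall x, 0 <= u x)%E ->
  (\int[P]_w u (X w) = \int[leb]_x (u x * (p x)%:E))%E.
Proof.
move=> mu u0; have mep : measurable_fun setT (EFin \o p).
  exact/measurable_EFinP.
rewrite -[LHS](@ge0_integral_distribution _ _ _ _ _ P X' u)//.
pose f_ := nnsfun_approx measurableT mu.
have mf_ n : measurable_fun [set: R] (EFin \o f_ n).
  exact/measurable_EFinP/measurable_funTS.
transitivity (lim (\int[m]_x (f_ n x)%:E @[n --> \oo])%E).
  rewrite -monotone_convergence//=.
  - apply: eq_integral => ? /[!inE] xD; apply/esym/cvg_lim => //=.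
    exact: cvg_nnsfun_approx.
  - by move=> n ? _; rewrite lee_fin.
  - by move=> ? _ ? ? mn; rewrite lee_fin; exact/lefP/nd_nnsfun_approx.
transitivity (lim (\int[leb]_x ((f_ n x)%:E * (p x)%:E) @[n --> \oo])%E).
  by apply: congr_lim; apply/funext => n; exact: integral_density_nnsfun.
rewrite -monotone_convergence//=.
- apply: eq_integral => x _; apply/cvg_lim => //=.
  apply: cvgeZr => //; exact: cvg_nnsfun_approx.
- by move=> n; exact: emeasurable_funM (mf_ n) mep.
- by move=> n ? _; rewrite mule_ge0 ?lee_fin.
- move=> x _ ? ? mn; apply: lee_wpmul2r; rewrite lee_fin//.
  by have /lefP := nd_nnsfun_approx measurableT mu mn; apply.
Qed.

Lemma has_mean_density (u : R -> R) (a : R) :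
  measurable_fun setT u -> (forall x, 0 <= u x) ->
  (\int[leb]_x ((u x)%:E * (p x)%:E) = a%:E)%E -> has_mean P (fun w => u (X w)) a.
Proof.
move=> mu u0 Eu; apply: ge0_has_mean => //; first exact: measurableT_comp.
rewrite unlock -Eu -(@integral_density (EFin \o u))//.
exact/measurable_EFinP.
Qed.

End density.

(** * Integration by parts between nonnegative integrands *)

(* Exhausting by compact intervals allows for integrands that are singular at the
   ends of the domain, as the gamma density of shape < 1 is at 0. *)
Section integral_of_difference.
Context (R : realType).
Local Notation leb := (@lebesgue_measure R).
Variables (F f g : R -> R) (a b : nat -> R).
Let D := \bigcup_n `[a n, b n]%classic.
Hypotheses (ab : forall n, a n < b n).
Hypotheses (nia : forall m n, (m <= n)%N -> a n <= a m)
           (ndb : forall m n, (m <= n)%N -> b m <= b n).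
Hypotheses (mf : measurable_fun setT f) (mg : measurable_fun setT g).
Hypotheses (f0 : forall x, 0 <= f x) (g0 : forall x, 0 <= g x).
Hypotheses (cf : forall x, D x -> {for x, continuous f})
           (cg : forall x, D x -> {for x, continuous g}).
Hypothesis F'E : forall x, D x -> is_derive x 1 F (f x - g x).
Hypotheses (Fa : F (a n) @[n --> \oo] --> (0 : R))
           (Fb : F (b n) @[n --> \oo] --> (0 : R)).

Lemma integral_eq_of_derive :
  (\int[leb]_(x in D) (f x)%:E = \int[leb]_(x in D) (g x)%:E)%E.
Proof.
pose I n := `[a n, b n]%classic.
have ID n x : I n x -> D x by exists n.
have mI n : measurable (I n : set (measurableTypeR R)) by exact: measurable_itv.
have ndI : {homo I : m n / (m <= n)%N >-> m `<=` n}.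
  move=> m n mn x; rewrite /I /= !in_itv/= => /andP[amx xbm].
  by rewrite (le_trans (nia mn) amx) (le_trans xbm (ndb mn)).
(* On a compact piece both integrals are finite, so the fundamental theorem for f - g can be split.
   The g-integral stays on the right-hand side, so that the limit never subtracts two possibly
   infinite values. *)
have IfE n : (\int[leb]_(x in I n) (f x)%:E =
    \int[leb]_(x in I n) (g x)%:E + (F (b n) - F (a n))%:E)%E.
  have wf : {within I n, continuous f}.
    by apply: continuous_in_subspaceT => x /[!inE] /ID /cf.
  have wg : {within I n, continuous g}.
    by apply: continuous_in_subspaceT => x /[!inE] /ID /cg.
  have cI : compact (I n) by exact: segment_compact.
  have intf : leb.-integrable (I n) (EFin \o f).
    exact: continuous_compact_integrable.
  have intg : leb.-integrable (I n) (EFin \o g).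
    exact: continuous_compact_integrable.
  have cF x : I n x -> {for x, continuous F}.
    move=> /ID /F'E[dF _].
    exact/differentiable_continuous/derivable1_diffP.
  have : (\int[leb]_(x in I n) ((f x)%:E - (g x)%:E) = (F (b n) - F (a n))%:E)%E.
    rewrite EFinB; apply: (@continuous_FTC2 _ (fun x => f x - g x)) => //.
    - move=> x; apply: cvgB; [exact: wf|exact: wg].
    - split.
      + move=> x xab; have [|//] := F'E (ID n x _).
        by apply: subset_itv_oo_cc.
      + apply: cvg_at_right_filter; apply: cF.
        by rewrite /I/= in_itv/= lexx ltW.
      + apply: cvg_at_left_filter; apply: cF.
        by rewrite /I/= in_itv/= lexx ltW.
    - move=> x xab; rewrite derive1E; have [|_ //] := F'E (ID n x _).
      by apply: subset_itv_oo_cc.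
  rewrite integralB_EFin//.
  move=> <-; rewrite addeC subeK//; exact: integrable_fin_num intg.
have cvI (u : R -> R) : measurable_fun setT u -> (forall x, 0 <= u x) ->
    ((\int[leb]_(x in I n) (u x)%:E) @[n --> \oo] --> \int[leb]_(x in D) (u x)%:E)%E.
  move=> mu u0; apply: ge0_nondecreasing_set_cvg_integral => //.
  - by move=> m n mn; exact/subsetPset/ndI.
  - by move=> n; apply/measurable_EFinP; exact: measurable_funTS.
  - by move=> n x _; rewrite lee_fin.
have cvF : ((F (b n) - F (a n))%:E @[n --> \oo] --> (0 : \bar R))%E.
  apply: cvg_EFin; first exact: nearW.
  by rewrite -[0]subr0; exact: cvgB.
(* The sum of the limits is defined even if the first one is infinite, the second being 0. *)
have /cvgeD /(_ (cvI g mg g0) cvF) : (\int[leb]_(x in D) (g x)%:E +? 0)%E.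
  by rewrite fin_num_adde_defl.
rewrite adde0 => cvg'.
have cvf := cvI f mf f0; move: cvf; rewrite (funext IfE) => cvf.
by apply: cvg_unique cvf cvg'; exact: ereal_hausdorff.
Qed.

End integral_of_difference.

(** * Moments of the standard normal law *)

Section normal_moments.
Context (R : realType).
Local Notation leb := (@lebesgue_measure R).
Local Notation phi := (@normal_pdf R 0 1).

Let phiE x : phi x = normal_peak 1 * expR (- (2^-1 * x ^+ 2)).
Proof.
rewrite normal_pdfE ?oner_eq0// /normal_fun subr0 expr1n.
by congr (_ * expR _); rewrite mulNr mulrC.
Qed.

Let is_derive_phi (x : R) : is_derive x 1 phi (- (x * phi x)).
Proof.
rewrite phiE; have -> : phi = fun x => normal_peak 1 * expR (- (2^-1 * x ^+ 2)).
  by apply/funext => y; exact: phiE.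
apply: is_derive_eq.
by rewrite /GRing.scale/=; field.
Qed.

Let cphi : continuous phi.
Proof. by apply: continuous_normal_pdf; exact: oner_neq0. Qed.

Let mphi : measurable_fun setT phi. Proof. exact: measurable_normal_pdf. Qed.

Let phi0 x : 0 <= phi x. Proof. exact: normal_pdf_ge0. Qed.

Let phi_opp x : phi (- x) = phi x.
Proof. by rewrite !phiE sqrrN. Qed.

(** With q = y^2 / 2, the bound exp(-q) <= 1/q gives y phi(y) <= 2 c / y, where c is
    [normal_peak 1]. *)
Let cvg_xphi : n.+1%:R * phi n.+1%:R @[n --> \oo] --> (0 : R).
Proof.
apply: (@squeeze_cvgr _ _ _ _ (cst 0) (fun n => 2 * normal_peak 1 * @harmonic R n)).
- apply: nearW => n; rewrite mulr_ge0//=.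
  rewrite phiE /harmonic/=; set y : R := n.+1%:R; have y0 : 0 < y by rewrite ltr0n.
  set q := 2^-1 * y ^+ 2; have q0 : 0 < q by rewrite mulr_gt0 ?exprn_gt0.
  have eq : expR (- q) <= q^-1.
    rewrite expRN lef_pV2 ?posrE ?expR_gt0//.
    by apply: le_trans (expR_ge1Dx _); rewrite lerDr.
  have c0 : 0 <= y * normal_peak 1 by rewrite mulr_ge0 ?normal_peak_ge0 ?ltW.
  rewrite mulrA; apply: (le_trans (ler_wpM2l c0 eq)).
  rewrite /q le_eqVlt; apply/orP; left; apply/eqP.
  by field; rewrite gt_eqF.
- exact: cvg_cst.
- by rewrite -(mulr0 (2 * normal_peak 1)); apply: cvgMr; exact: cvg_harmonic.
Qed.

Let cvg_phi : phi n.+1%:R @[n --> \oo] --> (0 : R).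
Proof.
apply: (@squeeze_cvgr _ _ _ _ (cst 0) (fun n => n.+1%:R * phi n.+1%:R)).
- by apply: nearW => n; rewrite phi0/= ler_peMl// ler1n.
- exact: cvg_cst.
- exact: cvg_xphi.
Qed.

(** Endpoints n + 1 rather than n keep the first interval nondegenerate, as [integral_eq_of_derive]
    requires. *)
Let bigcup_itv : \bigcup_n `[- n.+1%:R, n.+1%:R]%classic = [set: R].
Proof.
rewrite -subTset => x _; exists (Num.truncn `|x|) => //=.
by rewrite in_itv/= -ler_norml ltW// truncnS_gt.
Qed.

Let integral_phi (F f g : R -> R) :
  measurable_fun setT f -> measurable_fun setT g ->
  (forall x, 0 <= f x) -> (forall x, 0 <= g x) ->
  continuous f -> continuous g ->
  (forall x : R, is_derive x 1 F (f x - g x)) ->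
  F (- n.+1%:R) @[n --> \oo] --> (0 : R) -> F n.+1%:R @[n --> \oo] --> (0 : R) ->
  (\int[leb]_x (f x)%:E = \int[leb]_x (g x)%:E)%E.
Proof.
move=> mf mg f0 g0 cf cg dF Fa Fb.
rewrite -bigcup_itv; apply: (integral_eq_of_derive (F := F)) => //.
- by move=> n; rewrite (@lt_trans _ _ 0)// ?oppr_lt0 ltr0n.
- by move=> m n mn; rewrite lerN2 ler_nat.
- by move=> m n mn; rewrite ler_nat.
- by move=> x _; exact: cf.
- by move=> x _; exact: cg.
Qed.

(** F = - x phi has derivative x^2 phi - phi, so the second moment equals the total mass. *)
Let integral_sqr_phi : (\int[leb]_x ((x ^+ 2)%:E * (phi x)%:E) = 1)%E.
Proof.
rewrite -(integral_normal_pdf 0 1).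
under eq_integral do rewrite -EFinM.
apply: (integral_phi (F := fun x => - (x * phi x))) => //.
- by apply: measurable_funM => //; exact: measurable_funX.
- by move=> x; rewrite mulr_ge0 ?sqr_ge0.
- by move=> x; apply: cvgM; [exact: exprn_continuous|exact: cphi].
- move=> x; have dphi := is_derive_phi x; apply: is_derive_eq.
by rewrite /GRing.scale/=; ring.
- under eq_fun do rewrite phi_opp mulNr opprK; exact: cvg_xphi.
- have := cvgN cvg_xphi; rewrite oppr0; exact.
Qed.

(** This encodes E eps = 0 with nonnegative integrands, so that [integral_density] applies; their
    difference 2 x phi is the derivative of - 2 phi. *)
Let integral_odd_phi :
  (\int[leb]_x ((`|x| + x)%:E * (phi x)%:E) =
   \int[leb]_x ((`|x| - x)%:E * (phi x)%:E))%E.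
Proof.
under eq_integral do rewrite -EFinM.
under [RHS]eq_integral do rewrite -EFinM.
have mabs : measurable_fun [set: R] (fun x : R => `|x|) by exact: measurableT_comp.
have cvg2 : - (2 * phi n.+1%:R) @[n --> \oo] --> (0 : R).
  have : 2 * phi n.+1%:R @[n --> \oo] --> (2 * 0 : R).
    by apply: cvgM; [exact: cvg_cst|exact: cvg_phi].
  by move=> /cvgN; rewrite mulr0 oppr0.
apply: (integral_phi (F := fun x => - (2 * phi x))) => //.
- by apply: measurable_funM => //; exact: measurable_funD.
- by apply: measurable_funM => //; exact: measurable_funB.
- by move=> x; rewrite mulr_ge0// -lerBlDr sub0r -normrN ler_norm.
- by move=> x; rewrite mulr_ge0// subr_ge0 ler_norm.
- move=> x; apply: cvgM; last exact: cphi.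
  by apply: cvgD; [exact: norm_continuous|exact: cvg_id].
- move=> x; apply: cvgM; last exact: cphi.
  by apply: cvgB; [exact: norm_continuous|exact: cvg_id].
- move=> x; have dphi := is_derive_phi x; apply: is_derive_eq.
by rewrite /GRing.scale/=; ring.
- by under eq_fun do rewrite phi_opp; exact: cvg2.
Qed.

Definition normal_abs_mean : R := fine (\int[leb]_x (`|x|%:E * (phi x)%:E))%E.

Lemma normal_moments d (T : measurableType d) (P : probability T R) (X : T -> R) :
  has_law P X (normal_prob 0 1) ->
  [/\ has_mean P X 0, has_mean P (fun w => X w ^+ 2) 1 &
      has_mean P (fun w => `|X w|) normal_abs_mean].
Proof.
move=> lawX; have mX : measurable_fun setT X := lawX.1.
have h2 : has_mean P (fun w => X w ^+ 2) 1.
  apply: (has_mean_density mphi phi0 lawX (u := fun x => x ^+ 2)).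
  - exact: measurable_funX.
  - by move=> x; exact: sqr_ge0.
  - exact: integral_sqr_phi.
have [m hm _] := has_mean_sq h2 mX.
have mabs : measurable_fun [set: R] (fun x : R => `|x|) by exact: measurableT_comp.
have maX : measurable_fun setT (fun w => `|X w|) by exact: measurableT_comp.
have [a ha] : exists a, has_mean P (fun w => `|X w|) a.
  apply: (has_mean_le (has_meanD (has_mean_cst P 1) h2) maX) => w.
  rewrite normr_id -[X w ^+ 2]real_normK ?num_real//=.
  by move: `|X w| => y; nra.
have -> : normal_abs_mean = a.
  rewrite /normal_abs_mean -(integral_density mphi phi0 lawX (u := fun x => `|x|%:E))//.
    by rewrite (has_mean_integral ha).
  exact/measurable_EFinP.
suff m0 : m = 0 by rewrite -m0.
(* The means a + m and a - m agree by [integral_odd_phi], which forces m = 0. *)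
have hp := has_meanD ha hm; have hn := has_meanD ha (has_meanZ (-1) hm).
have E1 : (\int[P]_w (`|X w| + X w)%:E = \int[P]_w (`|X w| - X w)%:E)%E.
  rewrite (integral_density mphi phi0 lawX (u := fun x => (`|x| + x)%:E)).
  - rewrite (integral_density mphi phi0 lawX (u := fun x => (`|x| - x)%:E))//.
    + by apply/measurable_EFinP; exact: measurable_funB.
    + by move=> x; rewrite lee_fin subr_ge0 ler_norm.
  - by apply/measurable_EFinP; exact: measurable_funD.
  - by move=> x; rewrite lee_fin -lerBlDr sub0r -normrN ler_norm.
have E2 : (\int[P]_w (`|X w| - X w)%:E = (a + -1 * m)%:E)%E.
  by rewrite -(has_mean_integral hn); apply: eq_integral => w _; rewrite mulN1r.
move: E1; rewrite E2 (has_mean_integral hp) => -[]; lra.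
Qed.

End normal_moments.

(** * Moments of the gamma law *)

Section gamma_moments.
Context (R : realType).
Local Notation leb := (@lebesgue_measure R).
Implicit Types s k : R.

Lemma measurable_gamma_unnorm s : measurable_fun [set: R] (gamma_unnorm s).
Proof.
rewrite /gamma_unnorm; apply: measurable_fun_ifT => //.
- exact: measurable_fun_ltr.
- apply: measurable_funM; first exact: measurable_powR.
  by apply: measurableT_comp => //; exact: measurable_funN.
Qed.

Lemma gamma_unnorm_ge0 s (x : R) : 0 <= gamma_unnorm s x.
Proof.
by rewrite /gamma_unnorm; case: ifPn => // _; rewrite mulr_ge0 ?powR_ge0 ?expR_ge0.
Qed.

Let gammaE s (x : R) : 0 < x -> gamma_unnorm s x = x `^ (s - 1) * expR (- x).
Proof. by rewrite /gamma_unnorm => ->. Qed.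

(** For x > 0 the two terms are s times [gamma_unnorm s] and [gamma_unnorm (s + 1)], which makes the
    Gamma recursion an integration by parts. *)
Let is_derive_powR_expR s (x : R) : 0 < x ->
  is_derive x 1 (fun y => y `^ s * expR (- y))
    (s * (x `^ (s - 1) * expR (- x)) - x `^ s * expR (- x)).
Proof.
move=> x0; have dp := @is_derive1_powR R s x x0; apply: is_derive_eq.
by rewrite /GRing.scale/=; ring.
Qed.

Let continuous_gamma s (x : R) : 0 < x -> {for x, continuous (@gamma_unnorm R s)}.
Proof.
move=> x0; have [dF _] := is_derive_powR_expR (s - 1) x0.
have cF : {for x, continuous (fun y => y `^ (s - 1) * expR (- y))}.
  exact/differentiable_continuous/derivable1_diffP.
rewrite /prop_for /continuous_at gammaE//; apply: cvg_trans cF.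
apply: near_eq_cvg; near=> y; rewrite gammaE//.
by near: y; exact: lt_nbhsr.
Unshelve. all: by end_near. Qed.

(** With m the truncation of s, y^s <= y^(m+1) for y >= 1 and exp(y) >= y^(m+2) / (m+2)!, so the
    product is at most (m+2)! / y. *)
Let cvg_powR_expR s :
  (n.+2%:R `^ s * expR (- n.+2%:R) : R) @[n --> \oo] --> (0 : R).
Proof.
pose m := Num.truncn s.
apply: (@squeeze_cvgr _ _ _ _ (cst 0) (fun n => m.+2`!%:R * @harmonic R n)).
- apply: nearW => n; rewrite mulr_ge0 ?powR_ge0 ?expR_ge0//= /harmonic/=.
  set y : R := n.+2%:R; have y1 : 1 <= y by rewrite ler1n.
  have y0 : 0 < y by rewrite (lt_le_trans ltr01).
  have ys : y `^ s <= y ^+ m.+1.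
    rewrite -powR_mulrn ?(ltW y0)//; apply: ler_powR => //.
    by rewrite ltW// truncnS_gt.
  have ye : expR (- y) <= m.+2`!%:R / y ^+ m.+2.
    rewrite expRN -invf_div lef_pV2 ?posrE ?expR_gt0 ?divr_gt0 ?exprn_gt0 ?ltr0n ?fact_gt0//.
    by apply: le_trans (expR_ge1Dxn m.+1 (ltW y0)); rewrite lerDr.
  apply: (le_trans (ler_pM (powR_ge0 _ _) (expR_ge0 _) ys ye)).
  rewrite mulrCA ler_pM2l ?ltr0n ?fact_gt0//.
  rewrite (exprS y m.+1) invfM mulrCA divff ?mulr1 ?gt_eqF ?exprn_gt0//.
  by rewrite lef_pV2 ?posrE// ler_nat.
- exact: cvg_cst.
- rewrite -(mulr0 m.+2`!%:R); apply: cvgM; [exact: cvg_cst|exact: cvg_harmonic].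
Qed.

Let cvg_powR_expR0 s : 0 < s ->
  (n.+2%:R^-1 `^ s * expR (- n.+2%:R^-1) : R) @[n --> \oo] --> (0 : R).
Proof.
move=> s0.
have u0 n : 0 < (n.+2%:R^-1 : R) by rewrite invr_gt0.
have cu : (n.+2%:R^-1 : R) @[n --> \oo] --> (0 : R).
  apply: (@squeeze_cvgr _ _ _ _ (cst 0) (@harmonic R)).
  - by apply: nearW => n; rewrite (ltW (u0 n))/= lef_pV2 ?posrE// ler_nat.
  - exact: cvg_cst.
  - exact: cvg_harmonic.
have cp := (cvg_at_rightP _ _ _).1 (powR_cvg0 s0) _ (conj u0 cu).
apply: (@squeeze_cvgr _ _ _ _ (cst 0) (fun n => n.+2%:R^-1 `^ s)) => //.
- apply: nearW => n; rewrite mulr_ge0 ?powR_ge0 ?expR_ge0//=.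
  by rewrite ler_piMr ?powR_ge0// expR_le1 oppr_le0 ltW.
- exact: cvg_cst.
Qed.

(** Starting at 2 makes 1/(n+2) < n+2 strict already for n = 0. *)
Let bigcup_itv : \bigcup_n `[n.+2%:R^-1, n.+2%:R]%classic = `]0, +oo[%classic :> set R.
Proof.
apply/seteqP; split => x /=.
  move=> [n _]; rewrite /= !in_itv/= andbT => /andP[+ _]; apply: lt_le_trans.
  by rewrite invr_gt0 ltr0n.
rewrite in_itv/= andbT => x0.
exists (maxn (Num.truncn x) (Num.truncn x^-1)) => //=; rewrite in_itv/=.
apply/andP; split.
  rewrite -[leRHS]invrK lef_pV2 ?posrE ?invr_gt0 ?ltr0n//.
  apply: (le_trans (ltW (truncnS_gt _))).
  by rewrite ler_nat ltnS (leq_trans (leq_maxr _ _) (leqnSn _)).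
apply: (le_trans (ltW (truncnS_gt _))).
by rewrite ler_nat ltnS (leq_trans (leq_maxl _ _) (leqnSn _)).
Qed.

Let integral_gamma_pos s : (\int[leb]_x (gamma_unnorm s x)%:E =
  \int[leb]_(x in `]0%R, +oo[%classic) (gamma_unnorm s x)%:E)%E.
Proof.
rewrite [RHS]integral_mkcond; apply: eq_integral => x _; rewrite patchE.
case: ifPn => // /negP x0; rewrite /gamma_unnorm ifF//; apply/negP => x0'.
by apply: x0; rewrite inE/= in_itv/= x0'.
Qed.

(** Integrate the derivative of - x^s exp(-x) over ]0, +oo[. In the extended reals, finiteness of
    Gamma need not be known beforehand. *)
Lemma integral_gamma_unnormS s : 0 < s ->
  (\int[leb]_x (gamma_unnorm (s + 1) x)%:E =
   s%:E * \int[leb]_x (gamma_unnorm s x)%:E)%E.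
Proof.
move=> s0; rewrite !integral_gamma_pos -ge0_integralZl//; last 3 first.
- by apply/measurable_EFinP/measurable_funTS; exact: measurable_gamma_unnorm.
- by move=> x _; rewrite lee_fin gamma_unnorm_ge0.
- by rewrite lee_fin ltW.
under [RHS]eq_integral do rewrite -EFinM.
rewrite -bigcup_itv.
have Dgt0 (x : R) : (\bigcup_n `[n.+2%:R^-1, n.+2%:R]%classic) x -> 0 < x.
  by rewrite bigcup_itv/= in_itv/= andbT.
apply: (integral_eq_of_derive (F := fun x => - (x `^ s * expR (- x)))).
- move=> n; rewrite (@lt_trans _ _ 1)// ?invf_lt1 ?ltr0n// ltr1n//.
- by move=> m n mn; rewrite lef_pV2 ?posrE ?ltr0n// ler_nat.
- by move=> m n mn; rewrite ler_nat.
- exact: measurable_gamma_unnorm.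
- by apply: measurable_funM => //; exact: measurable_gamma_unnorm.
- by move=> x; exact: gamma_unnorm_ge0.
- by move=> x; rewrite mulr_ge0 ?gamma_unnorm_ge0// ltW.
- by move=> x /Dgt0; exact: continuous_gamma.
- move=> x /Dgt0 x0; apply: cvgM; [exact: cvg_cst|exact: continuous_gamma].
- move=> x /Dgt0 x0; rewrite !gammaE// addrK.
  have dF := is_derive_powR_expR s x0; apply: is_derive_eq.
  by rewrite opprB.
- have := cvgN (cvg_powR_expR0 s0); rewrite oppr0; exact.
- have := cvgN (@cvg_powR_expR s); rewrite oppr0; exact.
Qed.

(** Multiplying the density by x raises its shape by 1, so each moment costs one factor of the Gamma
    recursion: k, then k + 1. *)
Lemma gamma_moments d (T : measurableType d) (P : probability T R)
    (X : T -> R) k : 0 < k -> has_law P X (gamma_prob k) ->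
  [/\ {ae P, forall w, 0 <= X w}, has_mean P X k &
      has_mean P (fun w => X w ^+ 2) (k * (k + 1))].
Proof.
move=> k0 lawX; have mX : measurable_fun setT X := lawX.1.
have mp : measurable_fun setT (@gamma_pdf R k).
  by apply: measurable_funM => //; exact: measurable_gamma_unnorm.
have G0 : 0 <= Gamma_fun k.
  by apply/fine_ge0/integral_ge0 => x _; rewrite lee_fin gamma_unnorm_ge0.
have p0 x : 0 <= gamma_pdf k x.
  by rewrite divr_ge0// gamma_unnorm_ge0.
have X0 : {ae P, forall w, 0 <= X w}.
  exists (X @^-1` `]-oo, 0[); split.
  - by rewrite -[X in measurable X]setTI; exact: mX.
  - rewrite lawX.2// /gamma_prob integral0_eq// => x.
    rewrite /= in_itv/= => x0.
    by rewrite /gamma_pdf /gamma_unnorm ifF ?mul0r//; apply/negbTE; rewrite -leNgt ltW.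
  - by move=> w /= /negP; rewrite -ltNge in_itv.
have intp (u : R -> R) q : (forall x, u x * gamma_pdf k x = q x * (Gamma_fun k)^-1) ->
  (\int[leb]_x ((u x)%:E * (gamma_pdf k x)%:E) = \int[leb]_x ((Gamma_fun k)^-1%:E * (q x)%:E))%E.
  by move=> uq; apply: eq_integral => x _; rewrite -!EFinM uq mulrC.
have intG s : (\int[leb]_x ((Gamma_fun k)^-1%:E * (gamma_unnorm s x)%:E) =
    (Gamma_fun k)^-1%:E * \int[leb]_x (gamma_unnorm s x)%:E)%E.
  rewrite ge0_integralZl//.
  - by apply/measurable_EFinP; exact: measurable_gamma_unnorm.
  - by move=> x _; rewrite lee_fin gamma_unnorm_ge0.
  - by rewrite lee_fin invr_ge0.
(* The total mass of the law is 1, which rules out the junk value 0 of [fine] in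
   [Gamma_fun k]. *)
have int1 : ((Gamma_fun k)^-1%:E * \int[leb]_x (gamma_unnorm k x)%:E = 1)%E.
  have := lawX.2 setT measurableT; rewrite preimage_setT probability_setT => ->.
  rewrite -intG /gamma_prob; apply: eq_integral => x _.
  by rewrite /gamma_pdf EFinM muleC.
(* The identity function is negative on part of R and so not admissible in [has_mean_density].
   Replacing x by max(x, 0) changes nothing: the density vanishes for x <= 0, and X >= 0 almost
   surely. *)
have muE (x s : R) : Num.max x 0 * gamma_unnorm s x = gamma_unnorm (s + 1) x.
  rewrite /gamma_unnorm; case: ifPn => x0; last by rewrite mulr0.
  rewrite max_l ?ltW// mulrA; congr (_ * _).
  rewrite -{1}[x]powRr1 ?ltW// -powRD; first by congr powR; ring.
  by apply/implyP => _; rewrite gt_eqF.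
have mmax : measurable_fun [set: R] (fun x => Num.max x 0) by exact: measurable_maxr.
have max0 (x : R) : 0 <= Num.max x 0 by rewrite le_max lexx orbT.
have h1 : has_mean P (fun w => Num.max (X w) 0) k.
  apply: (has_mean_density mp p0 lawX (u := fun x => Num.max x 0)) => //.
  rewrite (intp _ (gamma_unnorm (k + 1))); last first.
    by move=> x; rewrite /gamma_pdf mulrA muE.
  by rewrite intG integral_gamma_unnormS// muleCA int1 mule1.
have h2 : has_mean P (fun w => Num.max (X w) 0 ^+ 2) (k * (k + 1)).
  apply: (has_mean_density mp p0 lawX (u := fun x => Num.max x 0 ^+ 2)).
  - exact: measurable_funX.
  - by move=> x; rewrite sqr_ge0.
  rewrite (intp _ (gamma_unnorm (k + 1 + 1))); last first.
    by move=> x; rewrite /gamma_pdf mulrA expr2 -[_ * _ * gamma_unnorm _ _]mulrA !muE.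
  rewrite intG (integral_gamma_unnormS (addr_gt0 k0 ltr01)) integral_gamma_unnormS//.
  rewrite muleCA (muleCA _ k%:E) int1 mule1.
  by rewrite -EFinM mulrC.
split=> //.
- by apply: (has_mean_ae h1) => //; apply: filterS X0 => w Xw; rewrite max_l.
- apply: (has_mean_ae h2); first exact: measurable_funX.
  by apply: filterS X0 => w Xw; rewrite max_l.
Qed.

End gamma_moments.

(** * Bounded recursions along the integers *)

(** Going back n steps gives b u <= q^n b (u - n) <= q^n K, and n is arbitrary since Z has no first
    element. *)
Lemma le0_of_contraction (R : realType) (b : int -> R) (q K : R) :
  0 <= q -> q < 1 -> (forall u, b u <= q * b (u - 1)) -> (forall u, b u <= K) ->
  forall u, b u <= 0.
Proof.
move=> q0 q1 bq bK u.
have bn (n : nat) : b u <= q ^+ n * K.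
  apply: (@le_trans _ _ (q ^+ n * b (u - n%:Z))); last first.
    by rewrite ler_wpM2l ?exprn_ge0.
  elim: n => [|n IHn]; first by rewrite expr0 mul1r subr0.
  rewrite (le_trans IHn)// exprSr -mulrA ler_wpM2l ?exprn_ge0//.
  by rewrite (le_trans (bq _))// -addn1 PoszD opprD addrA.
have cq : q ^+ n * K @[n --> \oo] --> (0 : R).
  rewrite -(mul0r K); apply: cvgM; last exact: cvg_cst.
  by apply: cvg_expr; rewrite ger0_norm.
rewrite -(cvg_lim (@Rhausdorff R) cq); apply: limr_ge; first by apply/cvg_ex; exists 0.
exact: nearW.
Qed.

(** The distance from [a] to the fixed point p / (1 - q) is a bounded contracting sequence. *)
Lemma affine_recursion_bounded (R : realType) (a : int -> R) (p q K : R) :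
  0 <= q -> q < 1 -> (forall u, a u = p + q * a (u - 1)) ->
  (forall u, `|a u| <= K) -> forall u, a u = p / (1 - q).
Proof.
move=> q0 q1 aE aK u; pose c := p / (1 - q).
have cE : c = p + q * c by rewrite /c; field; rewrite subr_eq0 gt_eqF.
apply/eqP; rewrite -subr_eq0 -normr_le0.
apply: (le0_of_contraction (b := fun u => `|a u - c|) (K := K + `|c|) q0 q1).
- move=> v; rewrite -[X in X * _](ger0_norm q0) -normrM le_eqVlt.
  by apply/orP; left; rewrite aE {1}cE; apply/eqP; congr (`|_|); ring.
- by move=> v; rewrite (le_trans (ler_normB _ _))// lerD2r.
Qed.

(** * Measurability with respect to a generated sigma-algebra *)

Section sigma_measurable.
Context d (T : measurableType d) (R : realType).

(** Retyping the domain gives access to the closure lemmas for measurable functions, so that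
    composites of past variables stay in the past. *)
Definition sigma_measurable (G : set (set T)) (X : T -> R) : Prop :=
  measurable_fun (setT : set (g_sigma_algebraType G)) X.

Lemma sigma_measurable_rv_gen (G : set (set T)) (I : Type) (X : I -> T -> R)
    (J : set I) (i : I) :
  J i -> rv_gen X J `<=` G -> sigma_measurable G (X i).
Proof.
move=> Ji XG _ B mB; rewrite setTI; apply: sub_sigma_algebra.
by apply: XG; exists i => //; exists B.
Qed.

Lemma has_mean_mul_indep2 (P : probability T R) (F G : set (set T))
    (X Y : T -> R) (a b : R) :
  indep2 P <<s F >> <<s G >> ->
  sigma_measurable F X -> sigma_measurable G Y ->
  has_mean P X a -> has_mean P Y b -> has_mean P (fun w => X w * Y w) (a * b).
Proof.
move=> FG mX mY; apply: has_mean_mul_indep => A B mA mB; apply: FG.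
- by have := mX measurableT A mA; rewrite setTI.
- by have := mY measurableT B mB; rewrite setTI.
Qed.

End sigma_measurable.

Section covariance_has_mean.
Context d (T : measurableType d) (R : realType) (P : probability T R).

Lemma covariance_has_mean (X Y : T -> R) (a b c : R) :
  has_mean P X a -> has_mean P Y b -> has_mean P (fun w => X w * Y w) c ->
  covariance P X Y = (c - a * b)%:E.
Proof.
move=> hX hY hXY.
rewrite covarianceE ?(has_mean_Lfun hX) ?(has_mean_Lfun hY) ?(has_mean_Lfun hXY)//.
by rewrite hX.2 hY.2 [X in (X - _)%E]hXY.2 -EFinM -EFinB.
Qed.

Lemma has_mean0_ae (X : T -> R) : has_mean P X 0 -> (forall w, 0 <= X w) ->
  {ae P, forall w, X w = 0}.
Proof.
move=> hX X0; have mX : measurable_fun setT (EFin \o X).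
  exact/measurable_EFinP/has_mean_measurable/hX.
have : (\int[P]_w `|(EFin \o X) w| = 0)%E.
  under eq_integral do rewrite /= ger0_norm//.
  exact: has_mean_integral.
move/(ae_eq_integral_abs P measurableT mX).
by apply: filterS => w /= /(_ I) [].
Qed.

End covariance_has_mean.

(** * Moments of the volatility and covariances of the intervals *)

Section int_garch.
Context d (T : measurableType d) (R : realType) (P : probability T R).
Context (mu alpha beta gamma k : R) (eps eta h : int -> T -> R).
Hypotheses (mu0 : 0 < mu) (alpha0 : 0 < alpha) (beta0 : 0 < beta).
Hypotheses (gamma0 : 0 < gamma) (k0 : 0 < k).
Hypothesis law_eps : forall t, has_law P (eps t) (normal_prob 0 1).
Hypothesis law_eta : forall t, has_law P (eta t) (gamma_prob k).
Hypothesis eps_eta :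
  indep2 P (<<s rv_gen eps setT >>) (<<s rv_gen eta setT >>).

Let innov t := rv_gen eps [set t] `|` rv_gen eta [set t].
Let past t := rv_gen h [set s | s <= t] `|` rv_gen eps [set s | s < t]
          `|` rv_gen eta [set s | s < t].

Hypothesis innov_past : forall t, indep2 P <<s innov t >> <<s past t >>.
Hypothesis hE : forall t x, h t x = mu + alpha * `|h (t - 1) x * eps (t - 1) x|
  + beta * (h (t - 1) x * eta (t - 1) x) + gamma * h (t - 1) x.
Hypothesis mh : forall t, measurable_fun setT (h t).
Variable M : R.
Hypothesis h_bounded : forall t, ('E_P[h t ^+ 2] <= M%:E)%E.

Local Notation m := (normal_abs_mean R).
Let x u w := alpha * `|eps u w| + beta * eta u w + gamma.

Let innov_eps t : sigma_measurable (innov t) (eps t).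
Proof. by apply: (@sigma_measurable_rv_gen _ _ _ _ _ eps [set t]) => // A; left. Qed.

Let innov_eta t : sigma_measurable (innov t) (eta t).
Proof. by apply: (@sigma_measurable_rv_gen _ _ _ _ _ eta [set t]) => // A; right. Qed.

Let innov_x t : sigma_measurable (innov t) (x t).
Proof.
apply: measurable_funD; last exact: measurable_cst.
apply: measurable_funD; apply: measurable_funM; try exact: measurable_cst.
- by apply: measurableT_comp => //; exact: innov_eps.
- exact: innov_eta.
Qed.

Let past_h s t : s <= t -> sigma_measurable (past t) (h s).
Proof.
by move=> st; apply: (@sigma_measurable_rv_gen _ _ _ _ _ h [set s | s <= t]) => // A; left; left.
Qed.

Let past_eps s t : s < t -> sigma_measurable (past t) (eps s).
Proof.
by move=> st; apply: (@sigma_measurable_rv_gen _ _ _ _ _ eps [set s | s < t]) => // A; left; right.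
Qed.

Let past_eta s t : s < t -> sigma_measurable (past t) (eta s).
Proof.
by move=> st; apply: (@sigma_measurable_rv_gen _ _ _ _ _ eta [set s | s < t]) => // A; right.
Qed.

(** The moments of h, lambda and delta are all reduced to this factorization. *)
Let mean_past_innov t Y X a b :
  sigma_measurable (past t) Y -> sigma_measurable (innov t) X ->
  has_mean P Y a -> has_mean P X b -> has_mean P (fun w => Y w * X w) (a * b).
Proof.
move=> mY mX hY hX; rewrite mulrC.
have := has_mean_mul_indep2 (@innov_past t) mX mY hX hY.
by under eq_fun do rewrite mulrC.
Qed.

Let mean_eps t : has_mean P (eps t) 0.
Proof. by have [] := normal_moments (law_eps t). Qed.

Let mean_eps2 t : has_mean P (fun w => eps t w ^+ 2) 1.
Proof. by have [] := normal_moments (law_eps t). Qed.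

Let mean_abs_eps t : has_mean P (fun w => `|eps t w|) m.
Proof. by have [] := normal_moments (law_eps t). Qed.

Let eta_ge0 t : {ae P, forall w, 0 <= eta t w}.
Proof. by have [] := gamma_moments k0 (law_eta t). Qed.

Let mean_eta t : has_mean P (eta t) k.
Proof. by have [] := gamma_moments k0 (law_eta t). Qed.

Let mean_eta2 t : has_mean P (fun w => eta t w ^+ 2) (k * (k + 1)).
Proof. by have [] := gamma_moments k0 (law_eta t). Qed.

Let c1 := alpha * m + beta * k + gamma.

Let mean_x t : has_mean P (x t) c1.
Proof.
apply: has_meanD; last exact: has_mean_cst.
by apply: has_meanD; apply: has_meanZ.
Qed.

(** The cross term of x^2 is where independence of the two innovation sequences enters. *)
Let mean_abs_eps_eta t : has_mean P (fun w => `|eps t w| * eta t w) (m * k).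
Proof.
apply: (has_mean_mul_indep2 eps_eta) => //.
- apply: measurableT_comp => //.
  by apply: (@sigma_measurable_rv_gen _ _ _ _ _ eps setT).
- by apply: (@sigma_measurable_rv_gen _ _ _ _ _ eta setT).
Qed.

Let mean_x2 : exists c2, forall t, has_mean P (fun w => x t w ^+ 2) c2.
Proof.
eexists => t.
(* With y = alpha |eps| + beta eta, x = y + gamma gives x^2 = y^2 + 2 gamma x - gamma^2, which
   reuses the mean of x. *)
have := has_meanD (has_meanD (has_meanD (has_meanZ (alpha ^+ 2) (mean_eps2 t))
  (has_meanZ (beta ^+ 2) (mean_eta2 t)))
  (has_meanZ (2 * alpha * beta) (mean_abs_eps_eta t)))
  (has_meanD (has_meanZ (2 * gamma) (mean_x t)) (has_mean_cst P (- gamma ^+ 2))).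
congr has_mean; apply/funext => w; rewrite /x /=.
rewrite -[eps t w ^+ 2]real_normK ?num_real//; ring.
Qed.

Let mean_h2 u : exists2 v, has_mean P (fun w => h u w ^+ 2) v & v <= M.
Proof.
have m2 : measurable_fun setT (fun w => h u w ^+ 2) by exact: measurable_funX.
have E0 : (0 <= 'E_P[h u ^+ 2])%E.
  by apply: expectation_ge0 => w; exact: sqr_ge0.
have fE : 'E_P[h u ^+ 2]%E \is a fin_num.
  by rewrite ge0_fin_numE// (le_lt_trans (h_bounded u))// ltry.
exists (fine 'E_P[h u ^+ 2]%E); last by rewrite -lee_fin fineK.
apply: ge0_has_mean => //; first by move=> w; exact: sqr_ge0.
by rewrite fineK.
Qed.

Let mean_h u : exists2 e, has_mean P (h u) e & `|e| <= 1 + M.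
Proof.
have [v hv vM] := mean_h2 u; have [e he eb] := has_mean_sq hv (mh u).
by exists e => //; rewrite (le_trans eb)// lerD2l.
Qed.

Let abs_mean_ge0 : 0 <= m.
Proof.
by apply: (has_mean_le_ae (has_mean_cst P 0) (mean_abs_eps 0)); apply: aeW => w /=.
Qed.

Let c1_ge0 : 0 <= c1.
Proof.
by rewrite /c1 !addr_ge0// ?mulr_ge0// ltW.
Qed.

Hypothesis c1_lt1 : c1 < 1.

(* If h_{t-1} < 0 then h_t >= (beta eta_{t-1} + gamma) h_{t-1}, so the means of
   the negative parts contract by beta k + gamma < 1 and, being bounded,
   vanish. *)
Let h_ge0 u : {ae P, forall w, 0 <= h u w}.
Proof.
pose hm u w := Num.max (- h u w) 0.
have hm0 v w : 0 <= hm v w by rewrite le_max lexx orbT.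
have mhm v : measurable_fun setT (hm v).
  by apply: measurable_maxr => //; exact: measurableT_comp.
have hm_le v w : `|hm v w| <= 1 + h v w ^+ 2.
  by rewrite ger0_norm// ge_max; apply/andP; split; nra.
have mean_hm v : exists2 b, has_mean P (hm v) b & b <= 1 + M.
  have [v' hv vM] := mean_h2 v; have h1 := has_meanD (has_mean_cst P 1) hv.
  have [b hb] := has_mean_le h1 (mhm v) (hm_le v).
  exists b => //; apply: (@le_trans _ _ (1 + v')); last by rewrite lerD2l.
  apply: (has_mean_le_ae hb h1); apply: aeW => w.
  by rewrite (le_trans (ler_norm _) (hm_le v w)).
pose b v := projT1 (cid2 (mean_hm v)).
have hb v : has_mean P (hm v) (b v) by rewrite /b; case: cid2.
have bM v : b v <= 1 + M by rewrite /b; case: cid2.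
have bq v : b v <= (beta * k + gamma) * b (v - 1).
  rewrite mulrC.
  have hY : has_mean P (fun w => hm (v - 1) w * (beta * eta (v - 1) w + gamma))
      (b (v - 1) * (beta * k + gamma)).
    apply: (@mean_past_innov (v - 1)) => //.
    - apply: measurable_maxr; last exact: measurable_cst.
      by apply: measurableT_comp => //; exact: past_h.
    - apply: measurable_funD; last exact: measurable_cst.
      by apply: measurable_funM; [exact: measurable_cst|exact: innov_eta].
    - apply: has_meanD; last exact: has_mean_cst.
      exact: has_meanZ.
  apply: (has_mean_le_ae (hb v) hY); apply: filterS (eta_ge0 (v - 1)) => w.
  rewrite /hm hE; move: (h (v - 1) w) (eps (v - 1) w) (eta (v - 1) w) => y e n n0.
  have ye : 0 <= alpha * `|y * e| by rewrite mulr_ge0// ltW.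
  have bn : 0 <= beta * n by rewrite mulr_ge0// ltW.
  (* If y >= 0, every term of the recursion is nonnegative and the new negative part is 0. If y < 0,
     dropping the nonnegative terms mu and alpha |y e| only increases the negative part. *)
  have [y0|y0] := leP 0 y.
    rewrite [X in _ <= X * _]max_r ?oppr_le0// mul0r ge_max lexx andbT oppr_le0.
    by rewrite !addr_ge0// ?mulr_ge0// ltW.
  have -> : Num.max (- y) 0 = - y by rewrite max_l// oppr_ge0 ltW.
  rewrite ge_max; apply/andP; split.
    rewrite -subr_ge0; have -> : forall z, - y * (beta * n + gamma) -
        - (mu + z + beta * (y * n) + gamma * y) = mu + z by move=> z; ring.
    by rewrite addr_ge0// ltW.
  by rewrite mulr_ge0 ?oppr_ge0 ?addr_ge0// ltW.
have q0 : 0 <= beta * k + gamma by rewrite addr_ge0 ?mulr_ge0// ltW.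
(* The slope is [c1] without its nonnegative term alpha m. *)
have q1 : beta * k + gamma < 1.
  by apply: le_lt_trans c1_lt1; rewrite /c1 -addrA lerDr mulr_ge0// ltW.
have b0 : b u = 0.
  apply/le_anti; rewrite (le0_of_contraction q0 q1 bq bM)/=.
  apply: (has_mean_le_ae (has_mean_cst P 0) (hb u)); apply: aeW => w /=.
  exact: hm0.
have := hb u; rewrite b0 => hb0.
apply: filterS (has_mean0_ae hb0 (hm0 u)) => w hw.
by rewrite -oppr_le0 -[leRHS]hw le_max lexx.
Qed.

Let h_recursion u : {ae P, forall w, mu + h (u - 1) w * x (u - 1) w = h u w}.
Proof.
apply: filterS (h_ge0 (u - 1)) => w hw.
by rewrite (hE u) normrM (ger0_norm hw) /x; ring.
Qed.

Lemma mean_volatility u : has_mean P (h u) (mu / (1 - c1)).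
Proof.
pose e v := projT1 (cid2 (mean_h v)).
have he v : has_mean P (h v) (e v) by rewrite /e; case: cid2.
have eM v : `|e v| <= 1 + M by rewrite /e; case: cid2.
have eE v : e v = mu + c1 * e (v - 1).
  apply: (has_mean_unique (he v)); rewrite (mulrC c1).
  apply: has_mean_ae (h_recursion v) => //.
  apply: has_meanD; first exact: has_mean_cst.
  by apply: (@mean_past_innov (v - 1)) => //; exact: past_h.
by rewrite -(affine_recursion_bounded c1_ge0 c1_lt1 eE eM u).
Qed.

(** Squaring mu + h x gives slope c2 and constant term mu^2 + 2 mu c1 mu / (1 - c1) = mu^2 (1 + c1)
    / (1 - c1). Dividing by 1 - c2 yields the closed form, with both signs in the denominator
    reversed. *)
Lemma mean_volatility_sqr c2 u : (forall t, has_mean P (fun w => x t w ^+ 2) c2) ->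
  c2 < 1 -> has_mean P (fun w => h u w ^+ 2)
    (mu ^+ 2 * ((c1 + 1) / ((c2 - 1) * (c1 - 1)))).
Proof.
move=> hx2 c21; have c20 : 0 <= c2.
  apply: (has_mean_le_ae (has_mean_cst P 0) (hx2 0)); apply: aeW => w.
  exact: sqr_ge0.
pose v t := projT1 (cid2 (mean_h2 t)).
have hv t : has_mean P (fun w => h t w ^+ 2) (v t) by rewrite /v; case: cid2.
have vM t : `|v t| <= M.
  rewrite ger0_norm; first by rewrite /v; case: cid2.
  apply: (has_mean_le_ae (has_mean_cst P 0) (hv t)); apply: aeW => w.
  exact: sqr_ge0.
pose e := mu / (1 - c1).
have vE t : v t = (mu ^+ 2 + 2 * mu * (e * c1)) + c2 * v (t - 1).
  apply: (has_mean_unique (hv t)); rewrite (mulrC c2).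
  have h1 : has_mean P (fun w => h (t - 1) w * x (t - 1) w) (e * c1).
    apply: (@mean_past_innov (t - 1)) => //; first exact: past_h.
    exact: mean_volatility.
  have h2 : has_mean P (fun w => h (t - 1) w ^+ 2 * x (t - 1) w ^+ 2) (v (t - 1) * c2).
    apply: (@mean_past_innov (t - 1)) => //.
    - by apply: measurable_funX; exact: past_h.
    - by apply: measurable_funX; exact: innov_x.
  apply: (has_mean_ae (has_meanD (has_meanD (has_mean_cst P (mu ^+ 2))
    (has_meanZ (2 * mu) h1)) h2)); first exact: measurable_funX.
  by apply: filterS (h_recursion t) => w <-; rewrite /=; ring.
have -> : mu ^+ 2 * ((c1 + 1) / ((c2 - 1) * (c1 - 1))) = v u; last exact: hv.
rewrite (affine_recursion_bounded c20 c21 vE vM u) /e.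
have [n1 n2] : c1 != 1 /\ c2 != 1 by rewrite !lt_eqF.
by field; rewrite !subr_eq0 ![1 == _]eq_sym n1 n2.
Qed.

Let lam u w := h u w * eps u w.
Let del u w := h u w * eta u w.

Let mean_lam u : has_mean P (lam u) 0.
Proof.
rewrite -(mulr0 (mu / (1 - c1))); apply: (@mean_past_innov u) => //.
- exact: past_h.
- exact: mean_volatility.
Qed.

Let mean_del u : has_mean P (del u) (mu / (1 - c1) * k).
Proof.
apply: (@mean_past_innov u) => //; first exact: past_h.
exact: mean_volatility.
Qed.

Let mean_lam2 u v : has_mean P (fun w => h u w ^+ 2) v ->
  has_mean P (fun w => lam u w * lam u w) v.
Proof.
move=> hv; rewrite -(mulr1 v).
have := @mean_past_innov u _ _ _ _ _ _ hv (mean_eps2 u).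
under [X in _ -> _ -> has_mean P X _]eq_fun do rewrite -exprMn expr2.
by apply; apply: measurable_funX; [exact: past_h|exact: innov_eps].
Qed.

Let mean_del2 u v : has_mean P (fun w => h u w ^+ 2) v ->
  has_mean P (fun w => del u w * del u w) (v * (k * (k + 1))).
Proof.
move=> hv.
have := @mean_past_innov u _ _ _ _ _ _ hv (mean_eta2 u).
under [X in _ -> _ -> has_mean P X _]eq_fun do rewrite -exprMn expr2.
by apply; apply: measurable_funX; [exact: past_h|exact: innov_eta].
Qed.

(** The lambda part contributes v, as E lambda = 0, and the delta part k (k + 1) v - k^2 (E h)^2. *)
Lemma interval_cov_same u v : has_mean P (fun w => h u w ^+ 2) v ->
  interval_cov P (lam u) (del u) (lam u) (del u) =
  ((1 + k + k ^+ 2) * v - k ^+ 2 * (mu / (1 - c1)) ^+ 2)%:E.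
Proof.
move=> hv; rewrite /interval_cov.
rewrite (covariance_has_mean (mean_lam u) (mean_lam u) (mean_lam2 hv)).
rewrite (covariance_has_mean (mean_del u) (mean_del u) (mean_del2 hv)).
by rewrite -EFinD; congr EFin; ring.
Qed.

Lemma interval_cov_lt s t : s < t ->
  interval_cov P (lam s) (del s) (lam t) (del t) =
  (k%:E * 'E_P[(h s * h t * eta s)%R] - (k ^+ 2 * (mu / (1 - c1)) ^+ 2)%:E)%E.
Proof.
move=> st; have [vs hvs _] := mean_h2 s; have [vt hvt _] := mean_h2 t.
have meps u : measurable_fun setT (eps u) := (law_eps u).1.
have meta u : measurable_fun setT (eta u) := (law_eta u).1.
have sq (X : T -> R) v : has_mean P (fun w => X w * X w) v ->
  has_mean P (fun w => X w ^+ 2) v by [].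
(* Only the existence of the mean of lambda_s h_t matters, since it gets multiplied by E eps_t = 0;
   it follows from the second moments. *)
have [a ha] := has_mean_mul_le (sq _ _ (mean_lam2 hvs)) hvt
  (measurable_funM (mh s) (meps s)) (mh t).
(* [b] is E(delta_s h_t) = E(h_s h_t eta_s), the mixed moment that the formula keeps. *)
have [b hb] := has_mean_mul_le (sq _ _ (mean_del2 hvs)) hvt
  (measurable_funM (mh s) (meta s)) (mh t).
have hlam : has_mean P (fun w => lam s w * lam t w) 0.
  rewrite -(mulr0 a); under eq_fun do rewrite /lam mulrA.
  apply: (@mean_past_innov t) => //.
  apply: measurable_funM; last exact: past_h.
  by apply: measurable_funM; [apply: past_h; exact: ltW|exact: past_eps].
have hdel : has_mean P (fun w => del s w * del t w) (b * k).
  under eq_fun do rewrite /del mulrA.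
  apply: (@mean_past_innov t) => //.
  apply: measurable_funM; last exact: past_h.
  by apply: measurable_funM; [apply: past_h; exact: ltW|exact: past_eta].
rewrite /interval_cov (covariance_has_mean (mean_lam s) (mean_lam t) hlam).
rewrite (covariance_has_mean (mean_del s) (mean_del t) hdel).
have -> : ('E_P[(h s * h t * eta s)%R] = b%:E)%E.
  rewrite -hb.2; congr expectation; apply/funext => w /=.
  by rewrite /del !fctE; ring.
by rewrite -EFinM -EFinD -EFinB; congr EFin; ring.
Qed.

(** Ties C1 and C2, which the theorem reads off at a single time through [fine], to constants valid
    at all times. *)
Lemma innovation_moments u : exists2 c2,
  fine ('E_P[x u])%E = c1 /\ fine ('E_P[x u ^+ 2])%E = c2 &
  forall t, has_mean P (fun w => x t w ^+ 2) c2.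
Proof.
have [c2 hc2] := mean_x2; exists c2 => //; split; first by rewrite (mean_x u).2.
by rewrite [X in fine X](hc2 u).2.
Qed.

End int_garch.

Theorem theorem3 (d : measure_display) (T : measurableType d) (R : realType)
  (P : probability T R)
  (mu alpha1 beta1 gamma1 k : R)
  (eps eta h : int -> T -> R) :
  0 < mu -> 0 < alpha1 -> 0 < beta1 -> 0 < gamma1 -> 0 < k ->
  (* eps_t i.i.d. N(0,1), eta_t i.i.d. Gamma(k,1) *)
  (forall t, has_law P (eps t) (normal_prob 0 1)) ->
  (forall t, has_law P (eta t) (gamma_prob k)) ->
  indep_rvs P eps -> indep_rvs P eta ->
  (* the two sequences are mutually independent *)
  indep2 P (<<s rv_gen eps setT >>) (<<s rv_gen eta setT >>) ->
  (* (eps_t, eta_t) is independent of the past *)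
  (forall t, indep2 P
     (<<s rv_gen eps [set t] `|` rv_gen eta [set t] >>)
     (<<s rv_gen h [set s | s <= t] `|` rv_gen eps [set s | s < t]
          `|` rv_gen eta [set s | s < t] >>)) ->
  (* volatility recursion, lambda_t = h_t eps_t, delta_t = h_t eta_t *)
  (forall t x, h t x = mu + alpha1 * `|h (t - 1) x * eps (t - 1) x|
                  + beta1 * (h (t - 1) x * eta (t - 1) x)
                  + gamma1 * h (t - 1) x) ->
  (* started from the infinite past with finite (uniformly bounded)
     second moments *)
  (forall t, measurable_fun setT (h t)) ->
  (exists M : R, forall t, (('E_P[h t ^+ 2])%E <= M%:E)%E) ->
  forall t s : int,
  let x := fun u w => alpha1 * `|eps u w| + beta1 * eta u w + gamma1 in
  let C1 := fine ('E_P[x t])%E in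
  let C2 := fine ('E_P[x t ^+ 2])%E in
  C2 < C1 -> C1 < 1 ->
  let ts := (t + s)%R in
  let lam := fun u w => h u w * eps u w in
  let del := fun u w => h u w * eta u w in
  ('E_P[h t])%E = (mu / (1 - C1))%:E /\
  ('E_P[h t ^+ 2])%E = (mu ^+ 2 * ((C1 + 1) / ((C2 - 1) * (C1 - 1))))%:E /\
  (s = 0 ->
     interval_cov P (lam t) (del t) (lam ts) (del ts) =
     ((1 + k + k ^+ 2)%:E * ('E_P[h t ^+ 2])%E
      - (k ^+ 2)%:E * (('E_P[h t])%E * ('E_P[h t])%E))%E) /\
  (s != 0 ->
     interval_cov P (lam t) (del t) (lam ts) (del ts) =
     (k%:E * ('E_P[h t * h ts * eta (Num.min t ts)])%E
      - (k ^+ 2)%:E * (('E_P[h t])%E * ('E_P[h t])%E))%E).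
Proof.
move=> mu0 al0 be0 ga0 k0 leps leta _ _ epseta inno hE mh [M hM] t s x C1 C2.
have [c2 [C1E C2E] hc2] := innovation_moments alpha1 beta1 gamma1 k0 leps leta epseta t.
rewrite -/x in C1E C2E hc2; rewrite -/C1 in C1E; rewrite -/C2 in C2E.
move=> C21 C11; have c11 := C11; rewrite C1E in c11.
(* The second-moment recursion contracts because C2 < C1 < 1. *)
have c21 : c2 < 1 by rewrite -C2E (lt_trans C21).
have hm u := mean_volatility mu0 al0 be0 ga0 k0 leps leta inno hE mh hM c11 u.
have hm2 u := mean_volatility_sqr mu0 al0 be0 ga0 k0 leps leta inno hE mh hM c11 u
  hc2 c21.
have hlt a b := @interval_cov_lt _ _ _ _ _ _ _ _ _ _ _ _ mu0 al0 be0 ga0 k0 leps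
  leta inno hE mh _ hM c11 a b.
have h0 u := interval_cov_same mu0 al0 be0 ga0 k0 leps leta inno hE mh hM c11 (hm2 u).
move=> ts lam del.
have Eh : ('E_P[h t] = (mu / (1 - C1))%:E)%E by rewrite C1E; exact: (hm t).2.
have Eh2 : ('E_P[h t ^+ 2] = (mu ^+ 2 * ((C1 + 1) / ((C2 - 1) * (C1 - 1))))%:E)%E.
  by rewrite C1E C2E; exact: (hm2 t).2.
split; first exact: Eh.
split; first exact: Eh2.
split => [s0|s0].
  rewrite /ts s0 addr0 /lam /del h0 Eh2 Eh C1E C2E.
  by rewrite -!EFinM -EFinB -expr2.
have -> : ((k ^+ 2)%:E * ('E_P[h t] * 'E_P[h t]) =
    (k ^+ 2 * (mu / (1 - C1)) ^+ 2)%:E)%E by rewrite Eh -!EFinM -expr2.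
(* [interval_cov_lt] wants the earlier time first; that time is [Num.min t ts], the index of eta.
   The case split also evaluates this minimum. *)
rewrite C1E; have [tts|tst] := ltP t ts.
  exact: hlt.
have {}tst : ts < t.
  by rewrite lt_neqAle tst andbT /ts -subr_eq0 addrC addKr.
(* For s < 0 the symmetry of the covariance exchanges the two times. *)
have -> : (h t * h ts = h ts * h t)%R by rewrite mulrC.
rewrite /interval_cov covarianceC (covarianceC P (del t)).
exact: hlt.
Qed.
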